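(* Let $f(x)=\sum_{m=0}^{\infty}p_m x^m$ be an entire function and let $g(x)=\sum_{n=-\infty}^{\infty}q_n x^n$ be analytic on the annulus $K=\{z: s<|z|<S\}$, where $0\leq s<S$. Let $r$ be a nonnegative integer and let $f_r(x)=\sum_{m=r}^{\infty}p_m x^m$. If the series $$\sum_{n=-\infty}^{\infty}q_n\binom{n}{r}\frac{r!}{n^{r}}f_r(n)\,x^{n}$$ converges absolutely on $K$, then for all $x\in K$, $$\sum_{n=-\infty}^{\infty}q_n\binom{n}{r}\frac{r!}{n^{r}}f_r(n)\,x^{n}=\sum_{m=r}^{\infty}p_m\sum_{k=0}^{m}\left\{ {m \atop k}\right\}_r x^{k}g^{(k)}(x).$$
   Context: Here $\binom{n}{r}=\frac{n(n-1)\cdots(n-r+1)}{r!}$ for any integer $n$, and the expression $\binom{n}{r}\frac{r!}{n^r}f_r(n)$ stands for $\binom{n}{r}r!\sum_{m=r}^{\infty}p_m n^{m-r}$ (with $0^0=1$; in particular it is $0$ at $n=0$ when $r\ge1$). The $r$-Stirling numbers of the second kind $\left\{ {n \atop k}\right\}_r$ count partitions of $\{1,\dots,n\}$ into $k$ nonempty blocks with $1,\dots,r$ in distinct blocks; equivalently $\left\{ {n \atop k}\right\}_r=0$ for $n<r$, $=\delta_{k,r}$ for $n=r$, and $\left\{ {n \atop k}\right\}_r=\left\{ {n-1 \atop k-1}\right\}_r+k\left\{ {n-1 \atop k}\right\}_r$ for $n>r$.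
   Formalization: Absolute convergence on K is required of the double series over n and m≥r of q_n C(n,r) r! p_m n^(m-r) x^n, not just of the series over n; with the latter the claim fails, e.g. r=0, f(x)=sin(πx), g(x)=1/(1-x), 0<|x|<1. *)

(* Defs.v *)
From HB Require Import structures.
From mathcomp Require Import all_boot all_order all_algebra complex.
From mathcomp Require Import all_classical reals ereal topology normedtype.
From mathcomp Require Import sequences derive esum.

Set Implicit Arguments.
Unset Strict Implicit.
Unset Printing Implicit Defensive.

Import Order.TTheory GRing.Theory Num.Theory.
Import numFieldNormedType.Exports.

Local Open Scope classical_set_scope.
Local Open Scope ring_scope.
Local Open Scope complex_scope.

(* Topology and norm of the field R[i]; [derive1n] on R[i] is then the iterated
   complex derivative. *)
HB.instance Definition _ (R : realType) := NormedModule.copy R[i] R[i]^o.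

(* The elements 1, ..., n are encoded as 'I_n, so that 1, ..., r are the i < r.
   The test r <= n makes the number 0 when there are no r elements to separate. *)
Definition rstirling2 (r n k : nat) : nat :=
  if (r <= n)%N then
    #|[set P : {set {set 'I_n}} |
        [&& finset.partition P [set: 'I_n], #|P| == k &
          [forall i : 'I_n, forall j : 'I_n,
            [&& (i < r)%N, (j < r)%N & i != j] ==>
              (finset.pblock P i != finset.pblock P j)]]]%SET|
  else 0%N.

Section ComplexSeries.
Variable R : realType.
Local Notation C := R[i].

Definition binomz (n : int) (r : nat) : C :=
  (\prod_(i < r) (n%:~R - i%:R)) / r`!%:R.

Definition annulus (s S : R) : set C := [set z | s%:C < `|z| < S%:C].

Definition holomorphic_on (A : set C) (f : C -> C) : Prop :=
  forall z, A z -> derivable f z 1.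

Definition is_entire_series (p : nat -> C) (f : C -> C) : Prop :=
  holomorphic_on setT f /\
  forall z, series (fun m => p m * z ^+ m) @ \oo --> f z.

(* The nonnegative and the negative halves converge separately; Negz n is
   - n.+1. *)
Definition is_zsum (a : int -> C) (l : C) : Prop :=
  exists lp lm : C,
    [/\ series (fun n : nat => a (Posz n)) @ \oo --> lp,
        series (fun n : nat => a (Negz n)) @ \oo --> lm & l = lp + lm].

Definition is_laurent_series_on (A : set C) (q : int -> C) (g : C -> C) : Prop :=
  holomorphic_on A g /\
  forall z, A z -> is_zsum (fun n => q n * z ^ n) (g z).

(* f_r(z) / z^r, read at z = 0 as p_r. *)
Definition tail_quotient (p : nat -> C) (r : nat) (z : C) : C :=
  limn (fun M : nat => \sum_(r <= m < M) p m * z ^+ (m - r)).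

(* `|_| on R[i] takes real values inside R[i]; Re brings them back to R. The
   order of summation is irrelevant, so on T = int * nat this is the absolute
   convergence of an iterated series, with no intermediate inner sum. *)
Definition abs_summable (T : choiceType) (D : set T) (a : T -> C) : Prop :=
  (\esum_(t in D) (complex.Re `|a t|)%:E < +oo)%E.

End ComplexSeries.

(* Main.v *)
(* For n in Z, the identity
     n^(falling r) n^(m-r) = sum_k rstirling2 r m k * n^(falling k)
   and term-by-term differentiation, x^k g^(k)(x) = sum_n q_n n^(falling k) x^n,
   show that the m-th term on the right-hand side of the theorem is the sum over n
   of q_n n^(falling r) p_m n^(m-r) x^n; the theorem is then the exchange of the
   two summations, which absolute convergence allows.
   A sum over Z is handled as two series over nat, of the form
   sum_n c_n z^(e_n) with e = Posz or e = Negz. Both halves are differentiated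
   by the same estimates, because t |-> t^e is convex on t > 0 for every e in Z. *)

Require Import Defs.
From mathcomp Require Import all_boot all_order all_algebra complex.
From mathcomp Require Import all_classical reals ereal topology normedtype.
From mathcomp Require Import sequences derive esum.
From mathcomp Require Import ring lra.
Import Order.TTheory GRing.Theory Num.Theory.
Import numFieldNormedType.Exports.
Local Open Scope classical_set_scope.
Local Open Scope ring_scope.
Local Open Scope complex_scope.

Set Implicit Arguments.
Unset Strict Implicit.

(** * r-Stirling numbers and falling factorials *)

Lemma preim_partition_pblock (T : finType) (U : eqType) (f : T -> U) (x y : T) :
  (y \in finset.pblock (preim_partition f [set: T]%SET) x) = (f x == f y).
Proof.
rewrite pblock_equivalence_partition ?inE // => a b c _ _ _ /=.
by split=> // /eqP ->.
Qed.

Lemma preim_partition_pblock_eq (T : finType) (U : eqType) (f : T -> U) (x y : T) :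
  (finset.pblock (preim_partition f [set: T]%SET) x
     == finset.pblock (preim_partition f [set: T]%SET) y) = (f x == f y).
Proof.
have /and3P[/eqP cP tP _] := preim_partitionP f [set: T]%SET.
by rewrite eq_pblock ?cP ?inE // preim_partition_pblock.
Qed.

Lemma card_preim_partition (T U : finType) (P : {set {set T}}) :
  finset.partition P [set: T]%SET ->
  #|[set f : {ffun T -> U} | preim_partition f [set: T]%SET == P]%SET|
    = (#|U| ^_ #|P|)%N.
Proof.
move=> partP; have /and3P[/eqP cP tP nP] := partP.
have memP x : finset.pblock P x \in P by rewrite pblock_mem // cP inE.
pose B := {A : {set T} | A \in P}.
pose blk x : B := exist _ (finset.pblock P x) (memP x).
have exB (b : B) : exists x, x \in val b.
  by apply/set0Pn; apply: contraNneq nP => <-; exact: valP.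
pose elt (b : B) := xchoose (exB b).
have eltK b : blk (elt b) = b.
  by apply/val_inj/(def_pblock tP (valP b))/xchooseP.
pose F (h : {ffun B -> U}) : {ffun T -> U} := [ffun x => h (blk x)].
have injF : injective F.
  by move=> h1 h2 /ffunP e; apply/ffunP=> b; have := e (elt b); rewrite !ffunE eltK.
have -> : #|P| = #|{: B}| by rewrite card_sig.
rewrite -card_inj_ffuns -(card_imset _ injF); apply: eq_card => f.
rewrite inE; apply/eqP/imsetP.
- move=> fP; have fE x y : (blk x == blk y) = (f x == f y).
    by rewrite -val_eqE /= -(preim_partition_pblock_eq f) fP.
  exists [ffun b => f (elt b)].
    rewrite inE; apply/injectiveP => b1 b2; rewrite !ffunE => /eqP.
    by rewrite -fE !eltK => /eqP.
  by apply/ffunP=> x; rewrite !ffunE; apply/eqP; rewrite -fE eltK.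
- case=> h; rewrite inE => /injectiveP hinj ->.
  rewrite -[RHS](equivalence_partition_pblock partP).
  rewrite /preim_partition /equivalence_partition; apply: eq_imset => x.
  apply/setP=> y; rewrite !inE /= !ffunE (inj_eq hinj) -val_eqE /=.
  by rewrite eq_pblock // cP inE.
Qed.

Lemma card_ffun_inj_prefix (r d N : nat) :
  #|[set f : {ffun 'I_(r + d) -> 'I_N} |
      [forall i : 'I_(r + d), forall j : 'I_(r + d),
        [&& (i < r)%N, (j < r)%N & i != j] ==> (f i != f j)]]%SET|
    = (N ^_ r * N ^ d)%N.
Proof.
pose F (h : {ffun 'I_r -> 'I_N} * {ffun 'I_d -> 'I_N}) : {ffun 'I_(r + d) -> 'I_N} :=
  [ffun i : 'I_(r + d) => match fintype.split i with inl j => h.1 j | inr j => h.2 j end].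
have FK : cancel (fun f : {ffun 'I_(r + d) -> 'I_N} =>
    ([ffun i => f (lshift d i)], [ffun i => f (rshift r i)])) F.
  move=> f; apply/ffunP=> i; rewrite ffunE -[in RHS](splitK i).
  by case: (fintype.split i) => j; rewrite /= ffunE.
have FK' : cancel F (fun f : {ffun 'I_(r + d) -> 'I_N} =>
    ([ffun i => f (lshift d i)], [ffun i => f (rshift r i)])).
  case=> h1 h2; congr pair; apply/ffunP=> i; rewrite !ffunE.
    by rewrite (unsplitK (inl i)).
  by rewrite (unsplitK (inr i)).
have -> : (N ^_ r * N ^ d)%N
  = #|finset.setX [set h : {ffun 'I_r -> 'I_N} | injectiveb h]%SET [set: {ffun 'I_d -> 'I_N}]%SET|.
  by rewrite cardsX card_inj_ffuns cardsT card_ffun !card_ord.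
rewrite -(card_imset _ (can_inj FK')); apply: eq_card => f; rewrite inE.
apply/forallP/imsetP.
- move=> H; eexists; last by rewrite -[LHS]FK.
  rewrite !inE andbT; apply/injectiveP=> i j; rewrite !ffunE => /eqP fij.
  apply/eqP; apply: contraTT fij => nij.
  have /forallP/(_ (lshift d j)) := H (lshift d i).
  by rewrite /= !ltn_ord (inj_eq (@lshift_inj _ _)) nij.
- case=> -[h1 h2]; rewrite !inE andbT => /injectiveP hinj -> i.
  apply/forallP=> j; apply/implyP=> /and3P[ir jr nij]; rewrite !ffunE.
  have lsh (k : 'I_(r + d)) (kr : (k < r)%N) : k = lshift d (Ordinal kr) by exact/val_inj.
  rewrite (lsh _ ir) (lsh _ jr) !(unsplitK (inl _)) /= (inj_eq hinj).
  by apply: contraNneq nij => /(congr1 val) /= /val_inj ->.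
Qed.

Lemma card_partition_le (T : finType) (P : {set {set T}}) (D : {set T}) :
  finset.partition P D -> (#|P| <= #|D|)%N.
Proof.
move=> partP; rewrite (finset.card_partition partP) -sum1_card leq_sum // => A AP.
rewrite card_gt0; case/and3P: partP => _ _; apply: contraNneq => <-; exact: AP.
Qed.

Lemma sum_rstirling2_ffact (r m N : nat) : (r <= m)%N ->
  (\sum_(k < m.+1) rstirling2 r m k * N ^_ k = N ^_ r * N ^ (m - r))%N.
Proof.
move=> rm; pose sep (V : eqType) (f : 'I_m -> V) :=
  [forall i : 'I_m, forall j : 'I_m, [&& (i < r)%N, (j < r)%N & i != j] ==> (f i != f j)].
transitivity #|[set f : {ffun 'I_m -> 'I_N} | sep _ f]%SET|; last first.
  by move: (m - r)%N (subnKC rm) @sep => d <- /=; exact: card_ffun_inj_prefix.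
transitivity (\sum_(P : {set {set 'I_m}} | finset.partition P [set: 'I_m]%SET
   && sep _ (finset.pblock P)) N ^_ #|P|)%N.
  rewrite (partition_big (fun P : {set {set 'I_m}} => inord #|P| : 'I_m.+1) xpredT) //=.
  apply: eq_bigr => k _; rewrite /rstirling2 rm -sum1dep_card big_distrl /=.
  have cardK P : finset.partition P [set: 'I_m]%SET ->
      (inord #|P| == k) = (#|P| == k :> nat).
    by move=> /card_partition_le; rewrite cardsT card_ord -ltnS => H; rewrite -val_eqE /= inordK.
  apply: eq_big => [P|P /and3P[_ /eqP -> _]]; last by rewrite mul1n.
  by case: (boolP (finset.partition P _)) => //= /cardK ->; rewrite andbC.
rewrite -sum1dep_card (partition_big (fun f : {ffun 'I_m -> 'I_N} =>
  preim_partition f [set: 'I_m]%SET) (fun P => finset.partition P [set: 'I_m]%SET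
   && sep _ (finset.pblock P))) /=; last first.
  move=> f sf; rewrite preim_partitionP /=; apply/forallP=> i; apply/forallP=> j.
  by have /forallP/(_ i)/forallP/(_ j) := sf; rewrite preim_partition_pblock_eq.
apply: eq_bigr => P /andP[partP sepP].
rewrite -[in LHS](card_ord N) -card_preim_partition // -sum1dep_card; apply: eq_bigl => f.
case: eqP => [fP|]; last by rewrite andbF.
rewrite andbT; apply/esym/forallP=> i; apply/forallP=> j.
by rewrite -(preim_partition_pblock_eq f) fP; have /forallP/(_ i)/forallP/(_ j) := sepP.
Qed.

Lemma natr_ffact (F : pzRingType) (n k : nat) :
  (n ^_ k)%:R = \prod_(i < k) (n%:R - i%:R) :> F.
Proof.
elim: k => [|k IH]; first by rewrite big_ord0.
rewrite ffactnSr big_ord_recr /= -IH natrM; case: (leqP k n) => kn; first by rewrite natrB.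
by rewrite ffact_small // !mul0r.
Qed.

Lemma poly_eq_nat (F : numDomainType) (P Q : {poly F}) :
  (forall n : nat, P.[n%:R] = Q.[n%:R]) -> P = Q.
Proof.
move=> PQ; apply/eqP; rewrite -subr_eq0; apply: contraT => nz.
have := max_poly_roots nz (rs := [seq i%:R | i <- iota 0 (size (P - Q))]).
rewrite size_map size_iota ltnn; apply; last first.
  rewrite map_inj_uniq ?iota_uniq // => i j /eqP; rewrite eqr_nat; exact/eqP.
by apply/allP=> _ /mapP[i _ ->]; rewrite /root !hornerE PQ subrr.
Qed.

(* The identity is checked at natural numbers by counting functions, hence it
   holds as a polynomial identity, in particular at negative integers. *)
Lemma sum_rstirling2_prod (F : numDomainType) (r m : nat) (x : F) : (r <= m)%N ->
  \sum_(k < m.+1) (rstirling2 r m k)%:R * \prod_(i < k) (x - i%:R)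
    = (\prod_(i < r) (x - i%:R)) * x ^+ (m - r).
Proof.
move=> rm; pose ff k : {poly F} := \prod_(i < k) ('X - i%:R%:P).
have ffE k y : (ff k).[y] = \prod_(i < k) (y - i%:R).
  by rewrite /ff horner_prod; apply: eq_bigr => i _; rewrite !hornerE.
have : \sum_(k < m.+1) (rstirling2 r m k)%:R%:P * ff k = ff r * 'X^(m - r).
  apply: poly_eq_nat => n; rewrite horner_sum hornerM ffE hornerXn -natr_ffact.
  rewrite -natrX -natrM -sum_rstirling2_ffact // natr_sum; apply: eq_bigr => k _.
  by rewrite hornerM hornerC ffE -natr_ffact natrM.
move/(congr1 (fun P => P.[x])); rewrite horner_sum hornerM ffE hornerXn => <-.
by apply: eq_bigr => k _; rewrite hornerM hornerC ffE.
Qed.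

(** * Absolutely convergent double series *)

Lemma cvg_seriesDZ (K : numFieldType) (u v : nat -> K) (k a b : K) :
  series u @ \oo --> a -> series v @ \oo --> b ->
  series (fun n => u n + k * v n) @ \oo --> a + k * b.
Proof.
move=> ua vb; have -> : series (fun n => u n + k * v n)
    = (fun n => series u n + k * series v n).
  by apply/funext => n; rewrite /series /= big_split mulr_sumr.
by apply: cvgD => //; exact: cvgMl_tmp.
Qed.

Definition cmod (R : realType) (z : R[i]) : R := complex.Re `|z|.

Arguments cmod : simpl never.

Section DoubleSeries.
Variable R : realType.
Local Notation C := R[i].

Lemma norm_real_complex (x : R) : `|x%:C| = `|x|%:C :> C.
Proof. by rewrite normc_def /= expr0n addr0 sqrtr_sqr. Qed.

Lemma norm_cmod (z : C) : `|z| = (cmod z)%:C.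
Proof. by rewrite RRe_real // normr_real. Qed.

Lemma cmod0 : cmod (0 : C) = 0.
Proof. by rewrite /cmod normr0. Qed.

Lemma cmodN (z : C) : cmod (- z) = cmod z.
Proof. by rewrite /cmod normrN. Qed.

Lemma cmod_ge0 (z : C) : 0 <= cmod z.
Proof. by rewrite -lecR -norm_cmod; exact: normr_ge0. Qed.

Lemma cmodM (x y : C) : cmod (x * y) = cmod x * cmod y.
Proof. by apply: (@complexI R); rewrite rmorphM /= -!norm_cmod normrM. Qed.

Lemma cmodD (x y : C) : cmod (x + y) <= cmod x + cmod y.
Proof. by rewrite -lecR rmorphD /= -!norm_cmod ler_normD. Qed.

Lemma cmod_real (x : R) : cmod (x%:C) = `|x|.
Proof. by rewrite /cmod norm_real_complex. Qed.

Lemma cmodX (z : C) n : cmod (z ^+ n) = cmod z ^+ n.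
Proof. by apply: (@complexI R); rewrite rmorphXn /= -!norm_cmod normrX. Qed.

Lemma cmodV (z : C) : cmod z^-1 = (cmod z)^-1.
Proof. by apply: (@complexI R); rewrite fmorphV /= -!norm_cmod normfV. Qed.

Lemma cmodXz (z : C) (e : int) : cmod (z ^ e) = cmod z ^ e.
Proof. by case: e => n; rewrite ?NegzE -?exprnN -?exprnP ?cmodV cmodX. Qed.

Lemma cmod_int (e : int) : cmod (e%:~R : C) = `|e%:~R|.
Proof. by rewrite -(rmorph_int (real_complex R)) cmod_real. Qed.

Lemma cmod_nat n : cmod (n%:R : C) = n%:R.
Proof. by rewrite -(rmorph_nat (real_complex R)) cmod_real normr_nat. Qed.

Lemma cmod_eq0 (z : C) : (cmod z == 0) = (z == 0).
Proof. by rewrite -(inj_eq (@complexI R)) -norm_cmod normr_eq0. Qed.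

Lemma norm_Re_le (z : C) : `|complex.Re z| <= cmod z.
Proof. by rewrite -lecR -norm_cmod normc_ge_Re. Qed.

Lemma norm_Im_le (z : C) : `|complex.Im z| <= cmod z.
Proof.
rewrite -normrN -ReiNIm; apply: le_trans (norm_Re_le _) _.
by rewrite cmodM {2}/cmod complexiE normCi mulr1.
Qed.

Lemma cvg_real_complex (u : R^nat) (l : R) :
  u @ \oo --> l -> ((u n)%:C : C) @[n --> \oo] --> l%:C.
Proof.
move/cvgrPdist_lt => ul; apply/cvgrPdist_lt => e e0.
have er : e = (complex.Re e)%:C by rewrite RRe_real // gtr0_real.
move: e0; rewrite er (ltcR 0) => e0; near=> n.
by rewrite -rmorphB norm_real_complex ltcR; near: n; exact: ul.
Unshelve. all: by end_near. Qed.

Lemma nneg_double_series (b : nat -> nat -> R) (M : R) :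
  (forall i j, 0 <= b i j) ->
  (forall I J, \sum_(i < I) \sum_(j < J) b i j <= M) ->
  exists row l, [/\ forall i, series (b i) @ \oo --> row i,
    series row @ \oo --> l, l <= M &
    forall I J, \sum_(i < I) \sum_(j < J) b i j <= l].
Proof.
move=> b0 bM.
have cvgs (a : R^nat) m : (forall i, 0 <= a i) -> (forall n, series a n <= m) ->
    [/\ cvgn (series a), limn (series a) <= m & forall n, series a n <= limn (series a)].
  move=> a0 am.
  have nd : {homo series a : n p / (n <= p)%N >-> n <= p}.
    by apply/nondecreasing_seqP => n; rewrite /series /= big_nat_recr //= lerDl.
  have ca : cvgn (series a).
    by apply: nondecreasing_is_cvgn nd _; exists m => _ [n _ <-]; exact: am.
  split=> //; last exact: nondecreasing_cvgn_le.
  by apply: limr_le => //; near=> n; exact: am.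
have rowb i n : series (b i) n <= M.
  apply: le_trans (bM i.+1 n); rewrite big_ord_recr /= seriesEord /= lerDr.
  by apply: sumr_ge0 => k _; exact: sumr_ge0.
pose row i := limn (series (b i)).
have row_cvg i : series (b i) @ \oo --> row i.
  by have [] := cvgs _ _ (b0 i) (rowb i).
have row_ge i n : series (b i) n <= row i.
  by have [_ _] := cvgs _ _ (b0 i) (rowb i); exact.
have row0 i : 0 <= row i.
  by apply: le_trans (row_ge i 0%N); rewrite /series /= big_geq.
have rowM I : series row I <= M.
  have cI : \sum_(i < I) series (b i) J @[J --> \oo] --> \sum_(i < I) row i.
    by apply: cvg_big => [|i _]; [exact: add_continuous|exact: row_cvg].
  rewrite seriesEord /=; apply: (cvgr_to_le cI); near=> J.
  by apply: le_trans (bM I J); apply: ler_sum => i _; rewrite seriesEord.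
have [cr rM rge] := cvgs _ _ row0 rowM.
exists row, (limn (series row)); split=> // I J.
apply: le_trans (rge I); rewrite seriesEord; apply: ler_sum => i _.
by apply: le_trans (row_ge i J); rewrite seriesEord.
Unshelve. all: by end_near. Qed.

Definition iterable_series (b : nat -> nat -> C) :=
  exists (row col : nat -> C) (l : C), [/\ forall i, series (b i) @ \oo --> row i,
    forall j, series (b^~ j) @ \oo --> col j,
    series row @ \oo --> l & series col @ \oo --> l].

Lemma nneg_iterable_series (b : nat -> nat -> R) (M : R) :
  (forall i j, 0 <= b i j) ->
  (forall I J, \sum_(i < I) \sum_(j < J) b i j <= M) ->
  iterable_series (fun i j => (b i j)%:C).
Proof.
move=> b0 bM; have [row [l [rowc lc lM ble]]] := nneg_double_series b0 bM.
have [|col [l' [colc l'c l'l ble']]] :=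
    @nneg_double_series (fun j i => b i j) l (fun j i => b0 i j).
  by move=> I J; rewrite exchange_big.
have ll' : l = l'.
  apply/le_anti; rewrite l'l andbT; apply: (cvgr_to_le lc); near=> I.
  have cI : \sum_(i < I) series (b i) J @[J --> \oo] --> \sum_(i < I) row i.
    by apply: cvg_big => [|i _]; [exact: add_continuous|exact: rowc].
  rewrite seriesEord /=; apply: (cvgr_to_le cI); near=> J.
  apply: le_trans (ble' J I); rewrite [leRHS]exchange_big /=.
  by apply: ler_sum => i _; rewrite seriesEord.
have sC (a : R^nat) : series (fun n => (a n)%:C : C) = fun n => (series a n)%:C.
  by apply/funext => n; rewrite /series /= rmorph_sum.
exists (fun i => (row i)%:C), (fun j => (col j)%:C), l%:C; split=> [i|j||].
- by rewrite sC; exact: cvg_real_complex.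
- by rewrite (sC (b^~ j)); exact: cvg_real_complex.
- by rewrite sC; exact: cvg_real_complex.
- by rewrite sC ll'; exact: cvg_real_complex.
Unshelve. all: by end_near. Qed.

Lemma iterable_seriesDZ (b c : nat -> nat -> C) (k : C) :
  iterable_series b -> iterable_series c ->
  iterable_series (fun i j => b i j + k * c i j).
Proof.
move=> [row [col [l [h1 h2 h3 h4]]]] [row' [col' [l' [h1' h2' h3' h4']]]].
exists (fun i => row i + k * row' i), (fun j => col j + k * col' j), (l + k * l').
split=> [i|j||].
- exact: cvg_seriesDZ (h1 i) (h1' i).
- exact: (@cvg_seriesDZ _ (b^~ j) (c^~ j)) (h2 j) (h2' j).
- exact: cvg_seriesDZ h3 h3'.
- exact: cvg_seriesDZ h4 h4'.
Qed.

Lemma abs_iterable_series (b : nat -> nat -> C) (M : R) :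
  (forall I J, \sum_(i < I) \sum_(j < J) cmod (b i j) <= M) ->
  iterable_series b.
Proof.
move=> bM.
have real_case (c : nat -> nat -> R) : (forall i j, `|c i j| <= cmod (b i j)) ->
    iterable_series (fun i j => (c i j)%:C).
  move=> cb; have nM : iterable_series (fun i j => `|c i j|%:C).
    apply: (@nneg_iterable_series _ M) => // I J; apply: le_trans (bM I J).
    by apply: ler_sum => i _; apply: ler_sum.
  have pM : iterable_series (fun i j => (c i j + `|c i j|)%:C).
    apply: (@nneg_iterable_series _ (M + M)) => [i j|I J].
      by rewrite addrC -lerBlDr sub0r -normrN ler_norm.
    apply: le_trans (lerD (bM I J) (bM I J)); rewrite -big_split /=.
    apply: ler_sum => i _; rewrite -big_split /=; apply: ler_sum => j _.
    by rewrite lerD // (le_trans _ (cb i j)) // ler_norm.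
  have := iterable_seriesDZ (-1) pM nM; congr iterable_series.
  by apply/funext => i; apply/funext => j; rewrite mulN1r -rmorphB addrK.
have := iterable_seriesDZ 'i (real_case (fun i j => complex.Re (b i j))
  (fun i j => norm_Re_le _)) (real_case (fun i j => complex.Im (b i j))
  (fun i j => norm_Im_le _)).
by congr iterable_series; apply/funext => i; apply/funext => j; rewrite -complexE.
Qed.

End DoubleSeries.

(** * Estimates for integer powers *)

Section LaurentBounds.
Variable R : realType.
Local Notation C := R[i].

Lemma bernoulli_int (t : R) (e : int) : 0 < t -> 1 + e%:~R * (t - 1) <= t ^ e.
Proof.
have bern u n : 0 < u -> 1 + n%:R * (u - 1) <= u ^+ n :> R.
  move=> u0; elim: n => [|n IH]; first by rewrite mul0r addr0 expr0.
  rewrite exprS; apply: le_trans (ler_wpM2l (ltW u0) IH).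
  rewrite -natr1; set k : R := n%:R; have k0 : 0 <= k := ler0n R n.
  rewrite -subr_ge0 (_ : _ - _ = k * (u - 1) ^+ 2); last by ring.
  by rewrite mulr_ge0 ?sqr_ge0.
case: e => n t0; first exact: bern.
rewrite NegzE -exprnN -exprVn; apply: le_trans (bern _ _ _); last by rewrite invr_gt0.
have : 0 <= t^-1 * (t - 1) ^+ 2 by rewrite mulr_ge0 ?sqr_ge0 // invr_ge0 ltW.
have -> : t^-1 * (t - 1) ^+ 2 = t + t^-1 - 2 by field; rewrite gt_eqF.
by move=> h; rewrite mulrNz mulNr lerD2l -mulrN ler_wpM2l //; lra.
Qed.

Lemma exprz_slope (x h : R) (e : int) : 0 < h < x ->
  `|e%:~R| * x ^ e * h <= x * ((x + h) ^ e + (x - h) ^ e).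
Proof.
move=> /andP[h0 hx]; have x0 : 0 < x by lra.
have half u : 0 < u -> e%:~R * (x ^ e) * (u - x) <= x * u ^ e.
  move=> u0; have := bernoulli_int e (divr_gt0 u0 x0).
  have xe0 : 0 < x ^ e by exact: exprz_gt0.
  rewrite expfzMl -expfV -(ler_pM2r (mulr_gt0 x0 xe0)) => ineq.
  have e1 : (1 + e%:~R * (u / x - 1)) * (x * x ^ e) = x * x ^ e + e%:~R * x ^ e * (u - x).
    by field; rewrite gt_eqF.
  have e2 : u ^ e / x ^ e * (x * x ^ e) = x * u ^ e by field; rewrite gt_eqF.
  move: ineq; rewrite e1 e2; apply: le_trans; rewrite lerDr.
  by rewrite mulr_ge0 // ltW.
have hp := half (x + h) ltac:(lra).
have hm := half (x - h) ltac:(lra).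
have pp : 0 <= x * (x + h) ^ e by rewrite mulr_ge0 ?exprz_ge0 //; lra.
have pm : 0 <= x * (x - h) ^ e by rewrite mulr_ge0 ?exprz_ge0 //; lra.
rewrite (_ : x + h - x = h) in hp; last by ring.
rewrite (_ : x - h - x = - h) in hm; last by ring.
move: hp hm pp pm; rewrite mulrDr mulrN.
case: (lerP 0 (e%:~R : R)) => es hp hm pp pm.
  by rewrite ger0_norm //; apply: le_trans hp _; rewrite lerDl.
by rewrite ltr0_norm // !mulNr; apply: le_trans hm _; rewrite lerDr.
Qed.

Lemma taylor_pow (x y : C) (p2 : R) (n : nat) : cmod x <= p2 -> cmod y <= p2 ->
  p2 * cmod (y ^+ n.+1 - x ^+ n.+1 - n.+1%:R * (y - x) * x ^+ n)
    <= cmod (y - x) ^+ 2 * (n.+1%:R ^+ 2 * p2 ^+ n).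
Proof.
move=> xp yp; have p0 : 0 <= p2 := le_trans (cmod_ge0 x) xp.
elim: n => [|n IH].
  rewrite (_ : _ - _ - _ = 0) ?cmod0 ?mulr0; last by ring.
  by rewrite mulr_ge0 ?sqr_ge0 // mulr_ge0 ?sqr_ge0 ?expr0.
rewrite (_ : _ - _ - _ = y * (y ^+ n.+1 - x ^+ n.+1 - n.+1%:R * (y - x) * x ^+ n)
  + n.+1%:R * ((y - x) ^+ 2 * x ^+ n)); last by rewrite !exprS -!natr1; ring.
set phi := (y ^+ n.+1 - x ^+ n.+1 - _) in IH *.
have step : cmod (y * phi + n.+1%:R * ((y - x) ^+ 2 * x ^+ n))
    <= p2 * cmod phi + n.+1%:R * (cmod (y - x) ^+ 2 * p2 ^+ n).
  apply: le_trans (cmodD _ _) _; rewrite !cmodM !cmodX cmod_nat lerD ?ler_wpM2r ?cmod_ge0 //.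
  by rewrite !ler_wpM2l ?sqr_ge0 // lerXn2r ?nnegrE ?cmod_ge0.
apply: le_trans (ler_wpM2l p0 step) _.
apply: le_trans (ler_wpM2l p0 (lerD IH (lexx _))) _.
have d0 : 0 <= cmod (y - x) ^+ 2 * p2 ^+ n.+1 by rewrite mulr_ge0 ?sqr_ge0 ?exprn_ge0.
have k0 := ler0n R n.+1.
set D := cmod (y - x) ^+ 2 in d0 *; set k : R := n.+1%:R in k0 *.
rewrite -[n.+2%:R]natr1 -/k -subr_ge0.
rewrite (_ : _ - _ = (k + 1) * (D * p2 ^+ n.+1)); last by rewrite [p2 ^+ n.+1]exprS; ring.
by rewrite mulr_ge0 // addr_ge0.
Qed.

Lemma taylor_pow_inv (u v : C) (a : R) (n : nat) : u != 0 -> v != 0 ->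
  cmod u <= a -> cmod v <= a ->
  cmod (v ^+ n - u ^+ n + n%:R * (v^-1 - u^-1) * u ^+ n.+1)
    <= cmod (v^-1 - u^-1) ^+ 2 * (n%:R ^+ 2 * a ^+ n.+2).
Proof.
move=> u0 v0 ua va; have a0 : 0 <= a := le_trans (cmod_ge0 u) ua.
elim: n => [|n IH].
  by rewrite (_ : _ - _ + _ = 0) ?cmod0; [rewrite expr0n mul0r mulr0|ring].
set d := v^-1 - u^-1 in IH *.
set phi := (v ^+ n - u ^+ n + _) in IH.
rewrite (_ : _ - _ + _ = v * (phi + n.+1%:R * (d ^+ 2 * u ^+ n.+2))); last first.
  by rewrite /phi /d !exprS -!natr1; field; rewrite u0 v0.
rewrite cmodM; apply: le_trans (ler_wpM2r (cmod_ge0 _) va) _.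
have step : cmod (phi + n.+1%:R * (d ^+ 2 * u ^+ n.+2))
    <= cmod d ^+ 2 * (n%:R ^+ 2 * a ^+ n.+2) + n.+1%:R * (cmod d ^+ 2 * a ^+ n.+2).
  apply: le_trans (cmodD _ _) _; rewrite cmodM cmod_nat cmodM !cmodX lerD //.
  by rewrite !ler_wpM2l ?sqr_ge0 // lerXn2r ?nnegrE ?cmod_ge0.
apply: le_trans (ler_wpM2l a0 step) _.
have d0 : 0 <= cmod d ^+ 2 * a ^+ n.+3 by rewrite mulr_ge0 ?sqr_ge0 ?exprn_ge0.
have k0 := ler0n R n.
set D := cmod d ^+ 2 in d0 *; rewrite -[n.+1%:R]natr1; set k : R := n%:R in k0 *.
rewrite -subr_ge0 (_ : _ - _ = k * (D * a ^+ n.+3)); last by rewrite [a ^+ n.+3]exprS; ring.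
by rewrite mulr_ge0.
Qed.

Lemma taylor_exprz (x y : C) (p1 p2 : R) (e : int) : 0 < p1 ->
  p1 <= cmod x <= p2 -> p1 <= cmod y <= p2 ->
  cmod (y ^ e - x ^ e - e%:~R * (y - x) * x ^ (e - 1))
    <= cmod (y - x) ^+ 2 * (`|e%:~R| ^+ 2 * (p1 ^ (e - 2) + p2 ^ (e - 2))).
Proof.
move=> p10 /andP[px xp] /andP[py yp].
have p20 : 0 < p2 by apply: lt_le_trans (le_trans px xp).
have q1 f : 0 <= p1 ^ f by rewrite exprz_ge0 // ltW.
have q2 f : 0 <= p2 ^ f by rewrite exprz_ge0 // ltW.
case: e => [[|n]|n].
- rewrite (_ : _ - _ - _ = 0) ?cmod0; last by rewrite !expr0z subrr mul0r mul0r subr0.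
  by rewrite mulr_ge0 ?sqr_ge0 // mulr_ge0 ?sqr_ge0 ?addr_ge0.
- rewrite (_ : Posz n.+1 - 1 = n); last by rewrite intS addrAC subrr add0r.
  have p2n : p2 ^ (n.+1%:Z - 2) = p2 ^+ n / p2.
    rewrite (_ : n.+1%:Z - 2 = n%:Z + -1); last by rewrite intS; ring.
    by rewrite expfzDr ?gt_eqF.
  apply: le_trans (_ : cmod (y - x) ^+ 2 * (n.+1%:R ^+ 2 * p2 ^ (n.+1%:Z - 2)) <= _).
    rewrite p2n 2!mulrA ler_pdivlMr // [leLHS]mulrC -[leRHS]mulrA.
    exact: (@taylor_pow x y p2 n).
  by rewrite !ler_wpM2l ?sqr_ge0 // ger0_norm ?ler0n // ler_wpM2l ?sqr_ge0 ?lerDr.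
- have x0 : x != 0 by rewrite -cmod_eq0 gt_eqF // (lt_le_trans p10).
  have y0 : y != 0 by rewrite -cmod_eq0 gt_eqF // (lt_le_trans p10).
  have [ux uy] : cmod x^-1 <= p1^-1 /\ cmod y^-1 <= p1^-1.
    by rewrite !cmodV !lef_pV2 ?posrE ?(lt_le_trans p10).
  have := @taylor_pow_inv x^-1 y^-1 p1^-1 n.+1 (invr_neq0 x0) (invr_neq0 y0) ux uy.
  rewrite !invrK => T.
  have -> : y ^ Negz n - x ^ Negz n - (Negz n)%:~R * (y - x) * x ^ (Negz n - 1)
     = y^-1 ^+ n.+1 - x^-1 ^+ n.+1 + n.+1%:R * (y - x) * x^-1 ^+ n.+2.
    rewrite NegzE (_ : - n.+1%:Z - 1 = - n.+2%:Z).
      by rewrite -!exprnN !exprVn mulrNz !mulNr opprK.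
    by rewrite [n.+2%:Z]intS; ring.
  apply: le_trans T _; rewrite ler_wpM2l ?sqr_ge0 //.
  rewrite NegzE mulrNz normrN ger0_norm ?ler0n // ler_wpM2l ?sqr_ge0 //.
  rewrite (_ : - n.+1%:Z - 2 = - n.+3%:Z).
    by rewrite -exprnN exprVn lerDl.
  by rewrite [n.+3%:Z]intS [n.+2%:Z]intS; ring.
Qed.

End LaurentBounds.

(** * Term-by-term differentiation *)

Section NumFieldLimits.
Variable K : numFieldType.

Lemma limn_eq (u : nat -> K) (l : K) : u @ \oo --> l -> limn u = l.
Proof. exact: cvg_lim. Qed.

Lemma cvgn_unique (u : nat -> K) (a b : K) : u @ \oo --> a -> u @ \oo --> b -> a = b.
Proof. by move=> /limn_eq <- /limn_eq. Qed.

Lemma norm_series_lim_le (u : nat -> K) (l B : K) : series u @ \oo --> l ->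
  (forall N, \sum_(n < N) `|u n| <= B) -> `|l| <= B.
Proof.
move=> ul uB; have Breal : B \is Num.real.
  by apply: ger0_real; have := uB 0%N; rewrite big_ord0.
rewrite real_leNgt ?normr_real //; apply/negP => lB.
have e0 : 0 < `|l| - B by rewrite subr_gt0.
move/cvgrPdist_lt : ul => /(_ _ e0) [N _ /(_ N (leqnn N))] /=.
rewrite ltrBrDr => /(le_lt_trans _) H.
suff /H : `|l| <= `|l - series u N| + B by rewrite ltxx.
rewrite -lerBlDl; apply: le_trans (lerB_dist _ _) _.
rewrite opprB addrC subrK; apply: le_trans (uB N).
by rewrite seriesEord; exact: ler_norm_sum.
Qed.

Lemma norm_terms_bounded (u : nat -> K) (l : K) : series u @ \oo --> l ->
  exists B, forall n, `|u n| <= B.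
Proof.
move=> ul; have /cvg_seq_bounded[M [Mr HM]] : cvgn (series u) by apply/cvg_ex; exists l.
have sM n : `|series u n| <= M + 1 by apply: (HM (M + 1)) => //; rewrite ltrDl.
exists (M + 1 + (M + 1)) => n.
have -> : u n = series u n.+1 - series u n.
  by rewrite /series /= big_nat_recr //= addrAC subrr add0r.
by apply: le_trans (ler_normB _ _) _; exact: lerD.
Qed.

Lemma cvg_diff_quotient (F : K -> K) (x D B d : K) : 0 < d ->
  (forall h, `|h| < d -> `|F (h + x) - F x - h * D| <= `|h| ^+ 2 * B) ->
  h^-1 *: (F (h + x) - F x) @[h --> 0^'] --> D.
Proof.
move=> d0 HF; have B0 : 0 <= B.
  have h0 : 0 < d / 2 by rewrite divr_gt0.
  have := HF (d / 2); rewrite gtr0_norm // ltr_pdivrMr // ltr_pMr // ltr1n => /(_ isT).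
  by move/(le_trans (normr_ge0 _)); rewrite pmulr_rge0 // exprn_gt0.
apply/cvgrPdist_lt => e e0; near=> h.
have hn0 : h != 0 by near: h; exact: nbhs_dnbhs_neq.
have nh0 : 0 < `|h| by rewrite normr_gt0.
have hd : `|h| < d by near: h; exact: dnbhs0_lt.
have he : `|h| < e / (B + 1) by near: h; apply: dnbhs0_lt; rewrite divr_gt0 // ltr_wpDl.
rewrite distrC -(ltr_pM2l nh0) -normrM.
have -> : h * (h^-1 *: (F (h + x) - F x) - D) = F (h + x) - F x - h * D.
  by rewrite mulrBr /GRing.scale /= mulVKf.
apply: le_lt_trans (HF _ hd) _; rewrite expr2 -mulrA ltr_pM2l //.
apply: le_lt_trans (_ : _ <= `|h| * (B + 1)) _; first by rewrite ler_wpM2l // lerDl.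
by rewrite -ltr_pdivlMr // ltr_wpDl.
Unshelve. all: by end_near. Qed.

Lemma cvg_diff_quotientD (F G H : K -> K) (x a b : K) :
  (\forall h \near 0, H (h + x) = F (h + x) + G (h + x)) ->
  h^-1 *: (F (h + x) - F x) @[h --> 0^'] --> a ->
  h^-1 *: (G (h + x) - G x) @[h --> 0^'] --> b ->
  derive1 H x = a + b.
Proof.
move=> HE Fa Gb; apply: cvg_lim; first exact: norm_hausdorff.
have /near_eq_cvg : {near 0^', (fun h => h^-1 *: (F (h + x) - F x) + h^-1 *: (G (h + x) - G x))
    =1 (fun h => h^-1 *: (H (h + x) - H x))}.
  near=> h; rewrite -scalerDr; congr (_ *: _).
  have -> : H x = F x + G x by have := nbhs_singleton HE; rewrite add0r.
  have -> : H (h + x) = F (h + x) + G (h + x).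
    by near: h; exact: nbhs_dnbhs HE.
  by rewrite opprD addrACA.
by move/cvg_trans; apply; exact: cvgD.
Unshelve. all: by end_near. Qed.

End NumFieldLimits.

Section LaurentDerivation.
Variable R : realType.
Local Notation C := R[i].

Lemma abs_series_cvg (a : nat -> C) (M : R) :
  (forall N, \sum_(n < N) cmod (a n) <= M) -> exists l : C, series a @ \oo --> l.
Proof.
move=> aM; have M0 : 0 <= M by have := aM 0%N; rewrite big_ord0.
have [|row [col [l [/(_ 0%N) h _ _ _]]]] :=
    @abs_iterable_series R (fun i j => if i is 0%N then a j else 0) M.
  case=> [|I] J; first by rewrite big_ord0.
  rewrite big_ord_recl [X in _ + X]big1 ?addr0; first exact: aM.
  by move=> i _; apply: big1 => j _; rewrite cmod0.
by exists (row 0%N).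
Qed.

Lemma abel_abs_bound (c : nat -> C) (e : nat -> int) (a b t : R) (l : C) :
  0 < a -> 0 < b -> 0 < t < 1 -> (forall n, (b / a) ^ e n <= t ^+ n) ->
  series (fun n => c n * a%:C ^ e n) @ \oo --> l ->
  exists M, forall N, \sum_(n < N) cmod (c n) * b ^ e n <= M.
Proof.
move=> a0 b0 /andP[t0 t1] bat /norm_terms_bounded[B HB].
exists (cmod B / (1 - t)) => N.
have t1' : `|t| < 1 by rewrite gtr0_norm.
apply: le_trans (geometric_le_lim N (cmod_ge0 B) t0 t1'); rewrite seriesEord.
apply: ler_sum => n _ /=.
have -> : b ^ e n = a ^ e n * (b / a) ^ e n.
  by rewrite -expfzMl mulrCA divff ?gt_eqF // mulr1.
rewrite mulrA; apply: ler_pM (bat n).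
- by rewrite mulr_ge0 ?cmod_ge0 ?exprz_ge0 ?ltW.
- by rewrite exprz_ge0 // divr_ge0 ?ltW.
have -> : cmod (c n) * a ^ e n = cmod (c n * a%:C ^ e n).
  by rewrite cmodM cmodXz cmod_real (gtr0_norm a0).
have B0 : 0 <= B by apply: le_trans (HB 0%N).
have := HB n; rewrite -[X in _ <= X](ger0_norm B0).
by rewrite (norm_cmod (c n * _)) (norm_cmod B) lecR.
Qed.

Variables s S : R.
Hypothesis s0 : 0 <= s.

Lemma annulusP (z : C) : annulus s S z <-> s < cmod z < S.
Proof. by rewrite /annulus /= norm_cmod !ltcR. Qed.

Definition abs_on (c : nat -> C) (e : nat -> int) :=
  forall t : R, s < t < S -> exists M, forall N, \sum_(n < N) cmod (c n) * t ^ e n <= M.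

Lemma abs_on_mul (c : nat -> C) (e : nat -> int) :
  abs_on c e -> abs_on (fun n => c n * (e n)%:~R) e.
Proof.
move=> ce t /andP[st tS].
pose h := Num.min (t - s) (S - t) / 2.
have h0 : 0 < h by rewrite divr_gt0 // lt_min !subr_gt0 st.
have [h1 h2] : h < t - s /\ h < S - t.
  by split; rewrite /h; have [] := lerP (t - s) (S - t); lra.
have [M1 HM1] := ce (t + h) ltac:(apply/andP; split; lra).
have [M2 HM2] := ce (t - h) ltac:(apply/andP; split; lra).
have t0 : 0 < t := le_lt_trans s0 st.
exists (t / h * (M1 + M2)) => N.
apply: le_trans (ler_wpM2l (ltW (divr_gt0 t0 h0)) (lerD (HM1 N) (HM2 N))).
rewrite -big_split mulr_sumr; apply: ler_sum => n _ /=.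
rewrite cmodM cmod_int -mulrDr -mulrA [leRHS]mulrCA ler_wpM2l ?cmod_ge0 //.
rewrite mulrAC ler_pdivlMr //; apply: exprz_slope.
by rewrite h0 (lt_le_trans h1) // gerBl.
Qed.

Lemma abs_on_shift (c : nat -> C) (e : nat -> int) (k : int) :
  abs_on c e -> abs_on c (fun n => e n + k).
Proof.
move=> ce t tsS; have [M HM] := ce t tsS; 
have t0 : 0 < t by case/andP: tsS => st _; exact: le_lt_trans s0 st.
exists (M * t ^ k) => N; apply: le_trans (ler_wpM2r (exprz_ge0 k (ltW t0)) (HM N)).
by rewrite mulr_suml; apply: ler_sum => n _; rewrite expfzDr ?gt_eqF // mulrA.
Qed.

Definition laurent_sum (c : nat -> C) (e : nat -> int) (z : C) : C :=
  limn (series (fun n => c n * z ^ e n)).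

Lemma laurent_sum_cvg (c : nat -> C) (e : nat -> int) (z : C) : abs_on c e -> annulus s S z ->
  series (fun n => c n * z ^ e n) @ \oo --> laurent_sum c e z.
Proof.
move=> ce /annulusP zsS; have [M HM] := ce _ zsS.
have [|l hl] := @abs_series_cvg (fun n => c n * z ^ e n) M.
  by move=> N; apply: le_trans (HM N); apply: ler_sum => n _; rewrite cmodM cmodXz.
by rewrite /laurent_sum (limn_eq hl).
Qed.

Lemma laurent_sum_diff_quotient (c : nat -> C) (e : nat -> int) (x : C) :
  abs_on c e -> annulus s S x ->
  h^-1 *: (laurent_sum c e (h + x) - laurent_sum c e x) @[h --> 0^']
    --> laurent_sum (fun n => c n * (e n)%:~R) (fun n => e n - 1) x.
Proof.
move=> ce xA; have /annulusP/andP[sx xS] := xA.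
have ce1 := abs_on_shift (-1) (abs_on_mul ce).
have ce2 := abs_on_shift (-2) (abs_on_mul (abs_on_mul ce)).
pose d := Num.min (cmod x - s) (S - cmod x) / 2.
have d0 : 0 < d by rewrite divr_gt0 // lt_min !subr_gt0 sx.
have [d1 d2] : d < cmod x - s /\ d < S - cmod x.
  by split; rewrite /d; have [] := lerP (cmod x - s) (S - cmod x); lra.
have [M1 HM1] := ce2 (cmod x - d) ltac:(apply/andP; split; lra).
have [M2 HM2] := ce2 (cmod x + d) ltac:(apply/andP; split; lra).
apply: (@cvg_diff_quotient _ _ _ _ (M1 + M2)%:C d%:C); first by rewrite ltcR.
move=> h; rewrite norm_cmod ltcR => hd.
have xh1 : cmod x - d <= cmod (h + x) <= cmod x + d.
  have := cmodD h x; have := cmodD (h + x) (- h); rewrite addrAC subrr add0r cmodN.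
  by move=> u1 u2; apply/andP; split; lra.
have hxA : annulus s S (h + x) by apply/annulusP; case/andP: xh1 => *; apply/andP; split; lra.
have := cvg_seriesDZ (k := - h)
  (cvg_seriesDZ (k := -1) (laurent_sum_cvg ce hxA) (laurent_sum_cvg ce xA))
  (laurent_sum_cvg ce1 xA).
rewrite mulN1r mulNr => /norm_series_lim_le; apply => N.
rewrite -rmorphXn -rmorphM /=.
under eq_bigr do rewrite norm_cmod.
rewrite -rmorph_sum lecR /= mulrDr.
apply: le_trans (lerD (ler_wpM2l (sqr_ge0 _) (HM1 N)) (ler_wpM2l (sqr_ge0 _) (HM2 N))).
rewrite -mulrDr -big_split mulr_sumr; apply: ler_sum => n _ /=.
have -> : c n * (h + x) ^ e n + -1 * (c n * x ^ e n)
    + - h * (c n * (e n)%:~R * x ^ (e n + -1))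
  = c n * ((h + x) ^ e n - x ^ e n - (e n)%:~R * (h + x - x) * x ^ (e n - 1)).
  by rewrite addrK mulN1r mulNr !mulrBr; congr (_ - _); rewrite mulrCA !mulrA.
have xd0 : 0 < cmod x - d by apply: le_lt_trans s0 _; lra.
have x1 : cmod x - d <= cmod x <= cmod x + d by apply/andP; split; lra.
have := @taylor_exprz R x (h + x) _ _ (e n) xd0 x1 xh1.
rewrite addrK => /(ler_wpM2l (cmod_ge0 (c n))).
rewrite !cmodM !cmod_int => /le_trans; apply; rewrite le_eqVlt; apply/orP; left; apply/eqP.
by ring.
Qed.

End LaurentDerivation.

(** * Interchange of the summations *)

Section NumFieldSeries.
Variable K : numFieldType.

Lemma cvg_series_lincomb (m : nat) (a l : nat -> K) (u : nat -> nat -> K) :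
  (forall k, series (u k) @ \oo --> l k) ->
  series (fun n => \sum_(k < m) a k * u k n) @ \oo --> \sum_(k < m) a k * l k.
Proof.
move=> ul; elim: m => [|m IH].
  rewrite big_ord0 (_ : series _ = fun=> 0); first exact: cvg_cst.
  by apply/funext => N; rewrite /series /= big1 // => n _; rewrite big_ord0.
rewrite big_ord_recr /=.
have -> : (fun n => \sum_(k < m.+1) a k * u k n)
    = (fun n => \sum_(k < m) a k * u k n + a m * u m n).
  by apply/funext => n /=; rewrite big_ord_recr.
exact: cvg_seriesDZ.
Qed.

Lemma eq_cvgn (u v : nat -> K) (l : K) : u =1 v -> u @ \oo --> l -> v @ \oo --> l.
Proof. by move=> /funext ->. Qed.

Lemma eq_cvg_series (u v : nat -> K) (l : K) :
  u =1 v -> series u @ \oo --> l -> series v @ \oo --> l.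
Proof. by move=> /funext ->. Qed.

Lemma near_eq_cvgn (u v : nat -> K) (l : K) :
  (\forall n \near \oo, u n = v n) -> u @ \oo --> l -> v @ \oo --> l.
Proof. by move=> /near_eq_cvg /cvg_trans; exact. Qed.

Lemma cvg_power_tail (p : nat -> K) (r : nat) (z a : K) :
  series (fun m => p m * z ^+ m) @ \oo --> a ->
  exists l : K, (\sum_(r <= m < M) p m * z ^+ (m - r)) @[M --> \oo] --> l.
Proof.
move=> pa; have [->|z0] := eqVneq z 0.
  exists (p r); apply: (near_eq_cvgn _ (cvg_cst (p r))); near=> M.
  have rM : (r < M)%N by near: M; exact: nbhs_infty_gt.
  rewrite big_ltn // subnn expr0 mulr1 big1_seq ?addr0 // => m /=.
  rewrite mem_index_iota => /andP[rm _].
  by rewrite expr0n subn_eq0 leqNgt rm mulr0.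
exists (z ^- r * (a - series (fun m => p m * z ^+ m) r)).
have : z ^- r * (series (fun m => p m * z ^+ m) M - series (fun m => p m * z ^+ m) r)
    @[M --> \oo] --> z ^- r * (a - series (fun m => p m * z ^+ m) r).
  by apply: cvgMl_tmp; apply: cvgB => //; exact: cvg_cst.
apply: near_eq_cvgn; near=> M.
have rM : (r <= M)%N by near: M; exact: nbhs_infty_ge.
rewrite sub_series_geq // mulr_sumr; apply: eq_big_nat => m /andP[rm _].
by rewrite -{2}(subnK rm) exprD mulrCA [z ^+ _ * _]mulrC mulKf ?expf_neq0.
Unshelve. all: by end_near. Qed.

Lemma cvg_series_tail (w p : nat -> K) (k a : K) (r : nat) :
  (forall j, w j = if (r <= j)%N then k * p j else 0) ->
  (\sum_(r <= m < M) p m) @[M --> \oo] --> a ->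
  series w @ \oo --> k * a.
Proof.
move=> wE pa; have -> : series w = (fun M => k * \sum_(r <= m < M) p m); last exact: cvgMl_tmp.
apply/funext => M; rewrite /series /=.
rewrite (big_nat_widenl r 0) // [in RHS]big_mkcond mulr_sumr.
by apply: eq_bigr => j _; rewrite wE; case: ifP; rewrite ?mulr0.
Qed.

End NumFieldSeries.

Section Assembly.
Variable R : realType.
Local Notation C := R[i].
Variables s S : R.
Hypothesis s0 : 0 <= s.

Definition ffactz (k : nat) (n : int) : C := \prod_(i < k) (n%:~R - i%:R).

Definition laurent_sum_deriv (c : nat -> C) (e : nat -> int) (k : nat) : C -> C :=
  laurent_sum (fun n => c n * ffactz k (e n)) (fun n => e n - k%:Z).

Lemma ffactz_step (c : nat -> C) (e : nat -> int) (k : nat) :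
  ((fun n => c n * ffactz k (e n) * (e n - k%:Z)%:~R) = (fun n => c n * ffactz k.+1 (e n))) *
  ((fun n => e n - k%:Z - 1) = (fun n => e n - k.+1%:Z)).
Proof.
split; apply/funext => n; last by rewrite intS opprD addrA addrAC.
by rewrite /ffactz big_ord_recr /= -mulrA rmorphB.
Qed.

Lemma abs_on_ffactz (c : nat -> C) (e : nat -> int) (k : nat) : abs_on s S c e ->
  abs_on s S (fun n => c n * ffactz k (e n)) (fun n => e n - k%:Z).
Proof.
move=> ce; elim: k => [|k IH].
  have -> : (fun n => c n * ffactz 0 (e n)) = c.
    by apply/funext => n; rewrite /ffactz big_ord0 mulr1.
  by have -> : (fun n => e n - 0%:Z) = e by apply/funext => n; rewrite subr0.
have := abs_on_shift s0 (-1) (abs_on_mul s0 IH).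
by rewrite !ffactz_step.
Qed.

Lemma annulus_near (x : C) : annulus s S x -> \forall h \near (0 : C), annulus s S (h + x).
Proof.
move=> /annulusP/andP[sx xS].
have d0 : 0 < Num.min (cmod x - s) (S - cmod x) by rewrite lt_min !subr_gt0 sx.
near=> h.
have : `|h| < (Num.min (cmod x - s) (S - cmod x))%:C.
  by near: h; apply: nbhs0_lt; rewrite (ltcR 0).
rewrite norm_cmod ltcR lt_min => /andP[h1 h2].
have := cmodD h x; have := cmodD (h + x) (- h); rewrite addrAC subrr add0r cmodN.
by move=> u1 u2; apply/annulusP/andP; split; lra.
Unshelve. all: by end_near. Qed.

Lemma derive1n_laurent_sum (c1 c2 : nat -> C) (e1 e2 : nat -> int) (g : C -> C) :
  abs_on s S c1 e1 -> abs_on s S c2 e2 ->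
  (forall z, annulus s S z -> g z = laurent_sum c1 e1 z + laurent_sum c2 e2 z) ->
  forall k x, annulus s S x ->
    derive1n k g x = laurent_sum_deriv c1 e1 k x + laurent_sum_deriv c2 e2 k x.
Proof.
move=> ce1 ce2 gE; elim=> [|k IH] x xA.
  have l0 c e : laurent_sum_deriv c e 0 = laurent_sum c e.
    rewrite /laurent_sum_deriv; have -> : (fun n => c n * ffactz 0 (e n)) = c.
      by apply/funext => n; rewrite /ffactz big_ord0 mulr1.
    by have -> : (fun n => e n - 0%:Z) = e by apply/funext => n; rewrite subr0.
  by rewrite !l0; exact: gE.
have d1 := laurent_sum_diff_quotient s0 (abs_on_ffactz k ce1) xA.
have d2 := laurent_sum_diff_quotient s0 (abs_on_ffactz k ce2) xA.
rewrite !ffactz_step in d1 d2.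
apply: (cvg_diff_quotientD _ d1 d2).
by near=> h; apply: IH; near: h; exact: annulus_near.
Unshelve. all: by end_near. Qed.

Lemma abs_summable_bound (a : int * nat -> C) (e : nat -> int) (r : nat) :
  injective e -> abs_summable [set u : int * nat | (r <= u.2)%N] a ->
  exists M : R, forall I J,
    \sum_(i < I) \sum_(j < J) cmod (if (r <= j)%N then a (e i, j : nat) else 0) <= M.
Proof.
move=> einj; rewrite /abs_summable; set E := (\esum_(t in _) _)%E => Elt.
have E0 : (0 <= E)%E by apply: esum_ge0 => u _; rewrite lee_fin; exact: cmod_ge0.
exists (fine E) => I J; rewrite -lee_fin fineK ?ge0_fin_numE //.
pose t := [seq (e i, j) | i <- index_iota 0 I, j <- index_iota r J].
apply: esum_ge; exists [set` t].
  split; first exact: finite_seq.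
  move=> u /= /allpairsP[[i j] /= [_]]; rewrite mem_index_iota => /andP[rj _] -> //=.
rewrite -fsbig_seq; last first.
  apply: allpairs_uniq; rewrite ?iota_uniq // => -[i j] [i' j'] _ _ /= [/einj -> ->] //.
rewrite big_allpairs_dep; under [leRHS]eq_bigr do rewrite sumEFin.
rewrite sumEFin lee_fin big_mkord; apply: ler_sum => i _.
rewrite (big_nat_widenl r 0) // [leRHS]big_mkcond big_mkord; apply: ler_sum => j _.
by case: ifP => _; rewrite ?cmod0.
Qed.

Lemma half_sum (p : nat -> C) (q : int -> C) (e : nat -> int) (r : nat) (x : C) :
  injective e -> abs_on s S (q \o e) e -> annulus s S x ->
  (forall z, exists a : C, series (fun m => p m * z ^+ m) @ \oo --> a) ->
  abs_summable [set u : int * nat | (r <= u.2)%N]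
    (fun u => q u.1 * (binomz R u.1 r * r`!%:R
                       * (p u.2 * u.1%:~R ^+ (u.2 - r))) * x ^ u.1) ->
  exists l : C,
    series (fun i => q (e i) * (binomz R (e i) r * r`!%:R
              * tail_quotient p r (e i)%:~R) * x ^ e i) @ \oo --> l /\
    series (fun j => if (r <= j)%N then p j * \sum_(k < j.+1)
              (rstirling2 r j k)%:R * x ^+ k * laurent_sum_deriv (q \o e) e k x else 0)
      @ \oo --> l.
Proof.
move=> einj qe xA pcvg /(abs_summable_bound einj)[M HM].
have [row [col [l [rowc colc rowl coll]]]] := @abs_iterable_series R
  (fun i j => if (r <= j)%N then q (e i) * (binomz R (e i) r * r`!%:R
     * (p j * (e i)%:~R ^+ (j - r))) * x ^ e i else 0) M HM.
have x0 : x != 0.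
  by rewrite -cmod_eq0 gt_eqF //; have /annulusP/andP[sx _] := xA; exact: le_lt_trans sx.
exists l; split; [apply: (eq_cvg_series _ rowl) => i|apply: (eq_cvg_series _ coll) => j].
- apply: (cvgn_unique (rowc i)).
  have [t tc] := pcvg (e i)%:~R; have [u uc] := cvg_power_tail r tc.
  have rearr (a b c d : C) : a * (b * c) * d = a * b * d * c by rewrite mulrA mulrAC.
  rewrite rearr /tail_quotient (limn_eq uc).
  by apply: (cvg_series_tail _ uc) => j; rewrite rearr.
- apply: (cvgn_unique (colc j)).
  have [rj|rj] := leqP r j; last first.
    rewrite (_ : series _ = fun=> 0); first exact: cvg_cst.
    by apply/funext => N; rewrite /series /= big1.
  rewrite mulr_sumr; under eq_bigr do rewrite mulrA.
  have H := @cvg_series_lincomb C j.+1 (fun k => p j * ((rstirling2 r j k)%:R * x ^+ k))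
    (fun k => laurent_sum_deriv (q \o e) e k x) _
    (fun k => laurent_sum_cvg (abs_on_ffactz k qe) xA).
  apply: (eq_cvg_series _ H) => i /=.
  have bE : binomz R (e i) r * r`!%:R = ffactz r (e i).
    by rewrite /binomz mulfVK // pnatr_eq0 -lt0n fact_gt0.
  rewrite bE [_ * (p j * _)]mulrCA -sum_rstirling2_prod // !mulr_sumr mulr_suml.
  apply: eq_bigr => k _.
  have -> : x ^ e i = x ^+ k * x ^ (e i - k%:Z).
    by rewrite [x ^+ k]exprnP -expfzDr // addrCA subrr addr0.
  have rearr (a b c d u v : C) : a * (b * c) * (d * u * v) = d * (a * (b * u)) * (c * v).
    by ring.
  exact: rearr.
Qed.

Lemma abs_on_pos (q : int -> C) (g : C -> C) :
  is_laurent_series_on (annulus s S) q g -> abs_on s S (q \o Posz) Posz.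
Proof.
move=> [_ qg] t /andP[st tS]; have t0 := le_lt_trans s0 st.
pose a := (t + S) / 2; have [ta aS] : t < a /\ a < S by rewrite /a; split; lra.
have a0 : 0 < a := lt_trans t0 ta.
have aA : annulus s S a%:C.
  by apply/annulusP; rewrite cmod_real gtr0_norm // aS (lt_trans st).
have [lp [lm [lpc _ _]]] := qg _ aA.
apply: (abel_abs_bound a0 t0 (t := t / a) _ _ lpc) => [|n]; last by rewrite -exprnP.
by rewrite divr_gt0 // ltr_pdivrMr // mul1r.
Qed.

Lemma abs_on_neg (q : int -> C) (g : C -> C) :
  is_laurent_series_on (annulus s S) q g -> abs_on s S (q \o Negz) Negz.
Proof.
move=> [_ qg] t /andP[st tS]; have t0 := le_lt_trans s0 st.
pose a := (s + t) / 2; have [sa at'] : s < a /\ a < t by rewrite /a; split; lra.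
have a0 : 0 < a := le_lt_trans s0 sa.
have aA : annulus s S a%:C.
  by apply/annulusP; rewrite cmod_real gtr0_norm // sa (lt_trans at').
have [lp [lm [_ lmc _]]] := qg _ aA.
have t1 : 0 < a / t < 1 by rewrite divr_gt0 // ltr_pdivrMr // mul1r.
apply: (abel_abs_bound a0 t0 t1 _ lmc) => n.
have /andP[t1' t1''] := t1.
by rewrite NegzE -exprnN -exprVn invf_div exprS ler_piMl ?exprn_ge0 ?ltW.
Qed.

End Assembly.

Theorem theorem2 (R : realType) (p : nat -> R[i]) (f : R[i] -> R[i])
    (q : int -> R[i]) (g : R[i] -> R[i]) (s S : R) (r : nat)
    (hf : is_entire_series p f)
    (hs : 0 <= s) (hsS : s < S)
    (hg : is_laurent_series_on (annulus s S) q g)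
    (habs : forall x : R[i], annulus s S x ->
       abs_summable [set u : int * nat | (r <= u.2)%N]
         (fun u => q u.1 * (binomz R u.1 r * r`!%:R
                            * (p u.2 * u.1%:~R ^+ (u.2 - r))) * x ^ u.1)) :
  forall x : R[i], annulus s S x ->
    exists2 l : R[i],
      is_zsum (fun n : int =>
        q n * (binomz R n r * r`!%:R * tail_quotient p r n%:~R) * x ^ n) l
    & (\sum_(r <= m < M) p m *
         \sum_(k < m.+1) (rstirling2 r m k)%:R * x ^+ k * derive1n k g x)
        @[M --> \oo] --> l.
Proof.
move=> x xA; have [_ gE] := hg.
have qp := abs_on_pos hs hg; have qm := abs_on_neg hs hg.
have pcvg z : exists a : R[i], series (fun m => p m * z ^+ m) @ \oo --> a.
  by exists (f z); exact: hf.2.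
have posI : injective Posz by move=> m n [].
have negI : injective Negz by move=> m n [].
have [lp [rp cp]] := half_sum hs posI qp xA pcvg (habs x xA).
have [lm [rm cm]] := half_sum hs negI qm xA pcvg (habs x xA).
exists (lp + lm); first by exists lp, lm; exact: (And3 rp rm erefl).
have gsum z : annulus s S z -> g z = laurent_sum (q \o Posz) Posz z + laurent_sum (q \o Negz) Negz z.
  move=> /[dup] zA /gE[a [b [ac bc ->]]].
  by rewrite (cvgn_unique ac (laurent_sum_cvg qp zA)) (cvgn_unique bc (laurent_sum_cvg qm zA)).
have := cvg_seriesDZ (k := 1) cp cm; rewrite mul1r.
apply: eq_cvgn => M.
rewrite [RHS](big_nat_widenl r 0) // [RHS]big_mkcond /series /=.
apply: eq_bigr => j _; rewrite mul1r; case: ifP => _; last by rewrite addr0.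
rewrite -mulrDr -big_split; congr (_ * _); apply: eq_bigr => k _ /=.
by rewrite -mulrDr (derive1n_laurent_sum hs qp qm gsum).
Qed.
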